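(* Let $\Lambda=K\Gamma/I$ be a finite dimensional path algebra modulo relations over a field $K$, with $\Gamma$ a quiver and $I$ an admissible ideal of $K\Gamma$, and let $J$ be the Jacobson radical of $\Lambda$. Suppose that $e_1$ and $e_2$ are vertices of $\Gamma$ (not necessarily distinct) and that $p,q\in K\Gamma\setminus I$ are paths from $e_1$ to $e_2$ with $\Lambda p\cap\Lambda q=0$ (where $p$ and $q$ are viewed as elements of $\Lambda$). Moreover, suppose that (i) the cyclic left $\Lambda$-module $\Lambda(p,q)$ generated by the element $(p,q)\in\Lambda^2$ has finite projective dimension, and that one of the following two conditions is satisfied: either (ii) whenever $M\in\mathcal{P}^\infty(\Lambda\text{-mod})$, then $f_p(e_1M\setminus JM)\cap f_q(e_1JM)=\varnothing$; or (ii') whenever $M\in\mathcal{P}^\infty(\Lambda\text{-mod})$, then $\ker(f_p)\subseteq\ker(f_q)$ and $\ker(f_p)\subseteq e_1JM$. Then the simple module $S_1=\Lambda e_1/Je_1$ does not have a right $\mathcal{P}^\infty(\Lambda\text{-mod})$-approximation.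
   Context: $\Lambda\text{-mod}$ is the category of finitely generated left $\Lambda$-modules, and $\mathcal{P}^\infty(\Lambda\text{-mod})$ is its full subcategory of modules of finite projective dimension. Vertices of $\Gamma$ are identified with the corresponding primitive idempotents of $\Lambda$. A path $p$ from $e_1$ to $e_2$ satisfies $p=e_2pe_1$ in $\Lambda$; for a left $\Lambda$-module $M$, $f_p:e_1M\to e_2M$ denotes the $K$-linear map $x\mapsto px$ (and similarly $f_q$). For a full subcategory $\mathfrak{A}$ of $\Lambda\text{-mod}$ and $X\in\Lambda\text{-mod}$, a right $\mathfrak{A}$-approximation of $X$ is a homomorphism $\varphi:A\to X$ with $A\in\mathfrak{A}$ such that each homomorphism $B\to X$ with $B\in\mathfrak{A}$ factors through $\varphi$. *)

(* Defs.v *)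
From HB Require Import structures.
From mathcomp Require Import all_boot all_order all_algebra.
From mathcomp Require Import boolp classical_sets.
From mathcomp Require Import finmap.
From mathcomp.multinomials Require Import monalg.

Set Implicit Arguments.
Unset Strict Implicit.
Unset Printing Implicit Defensive.

Import GRing.Theory.
Local Open Scope ring_scope.
Local Open Scope classical_set_scope.

(* Modules are lmodTypes over a pzRingType: the zero ring is not excluded. *)

Section Submodules.
Variable R : pzRingType.

Record submodule (M : lmodType R) := Submodule {
  submod_set :> M -> Prop;
  submod0 : submod_set 0;
  submodD : forall x y, submod_set x -> submod_set y -> submod_set (x + y);
  submodZ : forall (a : R) x, submod_set x -> submod_set (a *: x) }.

Section One.
Variables (M : lmodType R) (N : submodule M).

Definition submod_pred : {pred M} := fun x => `[< N x >].

Fact submod_pred_closed : subsemimod_closed submod_pred.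
Proof.
split=> [|a x /asboolP Nx]; last exact/asboolP/submodZ.
split=> [|x y /asboolP Nx /asboolP Ny]; first exact/asboolP/submod0.
exact/asboolP/submodD.
Qed.
HB.instance Definition _ :=
  GRing.isSubmodClosed.Build R M submod_pred submod_pred_closed.

(* The submodule N as a module in its own right. *)
Definition submod_type := {x : M | submod_pred x}.
HB.instance Definition _ := SubChoice.on submod_type.
HB.instance Definition _ :=
  [SubChoice_isSubLmodule of submod_type by <:].

(* The quotient module M / N. *)
Definition quotmod := Quotient.quot submod_pred.
HB.instance Definition _ := GRing.Zmodule.on quotmod.

Definition quotmod_pi : M -> quotmod := \pi_(Quotient.quot submod_pred)%qT.

Fact quotmod_pi_eq x y : quotmod_pi x = quotmod_pi y <-> N (x - y).
Proof.
split=> [/eqP|/asboolP Nxy]; last by apply/eqP; rewrite -Quotient.idealrBE.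
by rewrite -Quotient.idealrBE => /asboolP.
Qed.

Fact quotmod_piK x : quotmod_pi (repr x) = x.
Proof. exact: reprK. Qed.

Fact quotmod_pi_surj x : exists y, quotmod_pi y = x.
Proof. by exists (repr x); apply: quotmod_piK. Qed.

Fact quotmod_piD x y : quotmod_pi (x + y) = quotmod_pi x + quotmod_pi y.
Proof. by rewrite /quotmod_pi !piE. Qed.

Definition quotmod_scale (a : R) (x : quotmod) : quotmod :=
  quotmod_pi (a *: repr x).

Fact quotmod_piZ a x : quotmod_scale a (quotmod_pi x) = quotmod_pi (a *: x).
Proof.
by apply/quotmod_pi_eq; rewrite -scalerBr; apply/submodZ/quotmod_pi_eq/quotmod_piK.
Qed.

Fact quotmod_scaleA a b x :
  quotmod_scale a (quotmod_scale b x) = quotmod_scale (a * b) x.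
Proof. by rewrite -[x]quotmod_piK !quotmod_piZ scalerA. Qed.
Fact quotmod_scale1 : left_id 1 quotmod_scale.
Proof. by move=> x; rewrite -[x]quotmod_piK quotmod_piZ scale1r. Qed.
Fact quotmod_scaleDr : right_distributive quotmod_scale +%R.
Proof.
move=> a x y; rewrite -[x]quotmod_piK -[y]quotmod_piK.
by rewrite -quotmod_piD !quotmod_piZ scalerDr quotmod_piD.
Qed.
Fact quotmod_scaleDl x : {morph quotmod_scale^~ x : a b / a + b}.
Proof.
by move=> a b; rewrite -[x]quotmod_piK !quotmod_piZ scalerDl quotmod_piD.
Qed.
HB.instance Definition _ := GRing.Zmodule_isLmodule.Build R quotmod
  quotmod_scaleA quotmod_scale1 quotmod_scaleDr quotmod_scaleDl.

Fact quotmod_pi_linear : linear quotmod_pi.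
Proof. by move=> a x y; rewrite quotmod_piD -quotmod_piZ. Qed.
HB.instance Definition _ :=
  GRing.isLinear.Build R M quotmod *:%R quotmod_pi quotmod_pi_linear.

(* N' intersected with N, as a submodule of N. *)
Definition submod_in (N' : submodule M) : submodule submod_type.
Proof.
refine (@Submodule submod_type [set x : submod_type | N' (val x)] _ _ _)
  => /= [|x y|a x].
- exact: submod0.
- exact: submodD.
- exact: submodZ.
Defined.

End One.

(* The submodule generated by a subset. *)
Definition span (M : lmodType R) (S : set M) : submodule M.
Proof.
exists [set x | forall N : submodule M, S `<=` N -> N x] => /=.
- by move=> N _; apply: submod0.
- by move=> x y Sx Sy N SN; apply: submodD; [apply: Sx | apply: Sy].
- by move=> a x Sx N SN; apply/submodZ/Sx.
Defined.

Definition cyclic (M : lmodType R) (x : M) : submodule M.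
Proof.
exists [set a *: x | a in [set: R]].
- by exists 0; rewrite ?scale0r.
- by move=> _ _ [a _ <-] [b _ <-]; exists (a + b); rewrite ?scalerDl.
- by move=> b _ [a _ <-]; exists (b * a); rewrite ?scalerA.
Defined.

Definition fin_gen (M : lmodType R) : Prop :=
  exists (n : nat) (g : 'I_n -> M),
    forall x, exists a : 'I_n -> R, x = \sum_i a i *: g i.

End Submodules.

Section Radical.
Variable R : pzRingType.

(* Left ideals are the submodules of the regular left module R^o. *)
Definition maximal_left_ideal (L : submodule R^o) : Prop :=
  (L : set R^o) <> [set: R^o] /\
  forall L' : submodule R^o, L `<=` L' ->
    (L' : set R^o) = L \/ (L' : set R^o) = [set: R^o].

Definition jacobson : submodule R^o.
Proof.
exists [set x | forall L, maximal_left_ideal L -> L x] => /=.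
- by move=> L _; apply: submod0.
- by move=> x y Jx Jy L mL; apply: submodD; [apply: Jx | apply: Jy].
- by move=> a x Jx L mL; apply/submodZ/Jx.
Defined.

(* L e, for a left ideal L and an element e. *)
Definition lideal_mulr (L : submodule R^o) (e : R) : submodule R^o.
Proof.
exists [set (x * e : R^o) | x in (L : set R^o)].
- by exists 0; [apply: submod0 | rewrite mul0r].
- move=> _ _ [x Lx <-] [y Ly <-].
  by exists (x + y); [apply: submodD | rewrite mulrDl].
- by move=> a _ [x Lx <-]; exists (a *: x); [apply: submodZ | rewrite -mulrA].
Defined.

(* R e / J e. *)
Definition top_at (e : R) : lmodType R :=
  quotmod (submod_in (cyclic (e : R^o)) (lideal_mulr jacobson e)).

(* J M. *)
Definition radmod (M : lmodType R) : submodule M :=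
  span [set (j : R) *: x | j in (jacobson : set R^o) & x in [set: M]].

(* e X, for X a subset of M. *)
Definition emul (M : lmodType R) (e : R) (X : set M) : set M :=
  [set e *: x | x in X].

(* Kernel of the map e M -> M, x |-> a x. *)
Definition eker (M : lmodType R) (e a : R) : set M :=
  [set x | emul e [set: M] x /\ a *: x = 0].

End Radical.
Arguments eker {R} M e a.

Section Homological.
Variable R : pzRingType.

Definition projective (P : lmodType R) : Prop :=
  forall (M N : lmodType R) (g : {linear M -> N}) (f : {linear P -> N}),
    (forall y, exists x, g x = y) ->
    exists h : {linear P -> M}, forall x, g (h x) = f x.

(* There is an exact sequence
   0 -> P n -> ... -> P 1 -> P 0 -> M -> 0 with every P i projective. *)
Definition pdim_le (n : nat) (M : lmodType R) : Prop :=
  exists (P : nat -> lmodType R) (d : forall i, {linear P i.+1 -> P i})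
         (aug : {linear P 0%N -> M}),
  [/\ forall i, projective (P i),
      forall i, (n < i)%N -> forall x : P i, x = 0,
      forall y, exists x, aug x = y,
      forall x, aug x = 0 <-> exists y, d 0%N y = x
    & forall i x, d i x = 0 <-> exists y, d i.+1 y = x].

Definition finite_pdim (M : lmodType R) : Prop := exists n, pdim_le n M.

(* The objects of P^infty(R-mod). *)
Definition Pinfty (M : lmodType R) : Prop := fin_gen M /\ finite_pdim M.

(* A full subcategory is given by its class C of objects. *)
Definition right_approximation (C : lmodType R -> Prop) (X A : lmodType R)
    (phi : {linear A -> X}) : Prop :=
  C A /\ forall (B : lmodType R) (g : {linear B -> X}), C B ->
    exists h : {linear B -> A}, forall x, phi (h x) = g x.

Definition has_right_approximation (C : lmodType R -> Prop) (X : lmodType R) :=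
  exists (A : lmodType R) (phi : {linear A -> X}), right_approximation C phi.

End Homological.

Section Ideals.
Variable R : pzRingType.

Record ideal := Ideal {
  ideal_set :> R -> Prop;
  ideal0 : ideal_set 0;
  idealD : forall x y, ideal_set x -> ideal_set y -> ideal_set (x + y);
  idealMl : forall a x, ideal_set x -> ideal_set (a * x);
  idealMr : forall a x, ideal_set x -> ideal_set (x * a) }.

Definition gen_ideal (S : set R) : ideal.
Proof.
exists [set x | forall I : ideal, S `<=` I -> I x] => /=.
- by move=> I _; apply: ideal0.
- by move=> x y Sx Sy I SI; apply: idealD; [apply: Sx | apply: Sy].
- by move=> a x Sx I SI; apply/idealMl/Sx.
- by move=> a x Sx I SI; apply/idealMr/Sx.
Defined.

Definition ideal_mul (A B : ideal) : ideal :=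
  gen_ideal [set a * b | a in (A : set R) & b in (B : set R)].

Definition ideal_exp (A : ideal) (n : nat) : ideal :=
  iter n (ideal_mul A) (gen_ideal [set: R]).

Variable I : ideal.

Definition ideal_submod : submodule R^o :=
  @Submodule R R^o I (@ideal0 I) (@idealD I) (@idealMl I).

(* The quotient ring R / I. *)
Definition ringquot := quotmod ideal_submod.
HB.instance Definition _ := GRing.Zmodule.on ringquot.

Definition ringquot_pi : R -> ringquot := @quotmod_pi R R^o ideal_submod.

Fact ringquot_pi_eq x y : ringquot_pi x = ringquot_pi y <-> I (x - y).
Proof. exact: (@quotmod_pi_eq R R^o ideal_submod). Qed.
Fact ringquot_piK x : ringquot_pi (repr x) = x.
Proof. exact: (@quotmod_piK R R^o ideal_submod). Qed.
Fact ringquot_pi_surj x : exists y, ringquot_pi y = x.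
Proof. exact: (@quotmod_pi_surj R R^o ideal_submod). Qed.
Fact ringquot_piD x y : ringquot_pi (x + y) = ringquot_pi x + ringquot_pi y.
Proof. exact: (@quotmod_piD R R^o ideal_submod). Qed.

Definition ringquot_mul (x y : ringquot) : ringquot :=
  ringquot_pi (repr x * repr y).

Fact ringquot_piM x y :
  ringquot_mul (ringquot_pi x) (ringquot_pi y) = ringquot_pi (x * y).
Proof.
apply/ringquot_pi_eq; set x' := repr _; set y' := repr _.
have -> : x' * y' - x * y = x' * (y' - y) + (x' - x) * y.
  by rewrite mulrBr mulrBl addrA subrK.
by apply: idealD; [apply: idealMl | apply: idealMr];
   apply/ringquot_pi_eq/ringquot_piK.
Qed.

Fact ringquot_mulA : associative ringquot_mul.
Proof.
move=> x y z; rewrite -[x]ringquot_piK -[y]ringquot_piK -[z]ringquot_piK.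
by rewrite !ringquot_piM mulrA.
Qed.
Fact ringquot_mul1r : left_id (ringquot_pi 1) ringquot_mul.
Proof. by move=> x; rewrite -[x]ringquot_piK ringquot_piM mul1r. Qed.
Fact ringquot_mulr1 : right_id (ringquot_pi 1) ringquot_mul.
Proof. by move=> x; rewrite -[x]ringquot_piK ringquot_piM mulr1. Qed.
Fact ringquot_mulDl : left_distributive ringquot_mul +%R.
Proof.
move=> x y z; rewrite -[x]ringquot_piK -[y]ringquot_piK -[z]ringquot_piK.
by rewrite -ringquot_piD !ringquot_piM mulrDl ringquot_piD.
Qed.
Fact ringquot_mulDr : right_distributive ringquot_mul +%R.
Proof.
move=> x y z; rewrite -[x]ringquot_piK -[y]ringquot_piK -[z]ringquot_piK.
by rewrite -ringquot_piD !ringquot_piM mulrDr ringquot_piD.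
Qed.
HB.instance Definition _ := GRing.Zmodule_isPzRing.Build ringquot
  ringquot_mulA ringquot_mul1r ringquot_mulr1 ringquot_mulDl ringquot_mulDr.

Fact ringquot_pi_zmod_morphism : zmod_morphism ringquot_pi.
Proof. exact: (raddfB (@quotmod_pi R R^o ideal_submod)). Qed.
Fact ringquot_pi_monoid_morphism : monoid_morphism ringquot_pi.
Proof. by split=> // x y; rewrite -ringquot_piM. Qed.
HB.instance Definition _ :=
  GRing.isZmodMorphism.Build R ringquot ringquot_pi ringquot_pi_zmod_morphism.
HB.instance Definition _ :=
  GRing.isMonoidMorphism.Build R ringquot ringquot_pi
    ringquot_pi_monoid_morphism.

End Ideals.

(* A finite quiver; finiteness is forced when K Gamma / I is finite
   dimensional and unital with I contained in the square of the arrow ideal. *)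
Record quiver := Quiver {
  vertex : finType;
  arrow : finType;
  asource : arrow -> vertex;
  atarget : arrow -> vertex }.

Section Paths.
Variable G : quiver.

(* s, read from left to right, is a walk starting at v. *)
Fixpoint is_walk (v : vertex G) (s : seq (arrow G)) : bool :=
  if s is a :: s' then (asource a == v) && is_walk (atarget a) s' else true.

Definition walk_end (v : vertex G) (s : seq (arrow G)) : vertex G :=
  last v [seq atarget a | a <- s].

(* A path is its starting vertex with its arrows in order of traversal. *)
Record qpath := QPath {
  qpath_val : vertex G * seq (arrow G);
  qpath_walk : is_walk qpath_val.1 qpath_val.2 }.
HB.instance Definition _ := [isSub for qpath_val].
HB.instance Definition _ := [Choice of qpath by <:].

Definition qsource (p : qpath) : vertex G := (qpath_val p).1.
Definition qarrows (p : qpath) : seq (arrow G) := (qpath_val p).2.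
Definition qtarget (p : qpath) : vertex G := walk_end (qsource p) (qarrows p).

Definition qtriv (v : vertex G) : qpath := @QPath (v, [::]) isT.

Fact qarrow_walk (a : arrow G) : is_walk (asource a) [:: a].
Proof. by rewrite /= eqxx. Qed.
Definition qarrow (a : arrow G) : qpath := @QPath (_, [:: a]) (qarrow_walk a).

(* The path q p, that is, p followed by q; None if it does not exist. *)
Definition qcomp (q p : qpath) : option qpath :=
  if qtarget p == qsource q then insub (qsource p, qarrows p ++ qarrows q)
  else None.

Fact is_walk_cat v s t :
  is_walk v (s ++ t) = is_walk v s && is_walk (walk_end v s) t.
Proof. by elim: s v => //= a s IHs v; rewrite IHs andbA. Qed.

Variant qcomp_spec (q p : qpath) : option qpath -> Prop :=
| QComp r of qtarget p = qsource q & qsource r = qsource p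
    & qarrows r = qarrows p ++ qarrows q & qtarget r = qtarget q :
    qcomp_spec q p (Some r)
| QNone of qtarget p <> qsource q : qcomp_spec q p None.

Fact qcompP q p : qcomp_spec q p (qcomp q p).
Proof.
rewrite /qcomp; case: eqP => [pq|]; last by constructor.
case: insubP => [r _ rE|]; last first.
  rewrite /= is_walk_cat (qpath_walk p) -[walk_end _ _]/(qtarget p) pq.
  by rewrite (qpath_walk q).
have rs : qsource r = qsource p by rewrite /qsource rE.
have ra : qarrows r = qarrows p ++ qarrows q by rewrite /qarrows rE.
constructor=> //.
rewrite /qtarget rs ra /walk_end map_cat last_cat.
by rewrite -[last (qsource p) _]/(qtarget p) pq.
Qed.

Fact qpath_inj (p q : qpath) :
  qsource p = qsource q -> qarrows p = qarrows q -> p = q.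
Proof.
by case: p q => [[v s] /= ?] [[w t] /= ?] vw st; apply/val_inj/(congr2 pair).
Qed.

Fact qcompA r q p :
  obind (qcomp r) (qcomp q p) = obind (qcomp^~ p) (qcomp r q).
Proof.
case: (qcompP q p) => [s pq ss sa st|pq]; case: (qcompP r q) => [t qr ts ta tt|qr] //=.
- case: (qcompP r s) => [u su us ua ut|]; last by rewrite st.
  case: (qcompP t p) => [w pt ws wa wt|]; last by rewrite ts.
  by congr Some; apply: qpath_inj; rewrite ?us ?ws ?ss // ua wa sa ta catA.
- by case: (qcompP r s) => // ?; rewrite st.
- by case: (qcompP t p) => // ?; rewrite ts.
Qed.

Fact qcomp1 p : qcomp p (qtriv (qsource p)) = Some p.
Proof.
case: (qcompP p (qtriv (qsource p))) => [r _ rs ra _|[]//].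
by congr Some; apply: qpath_inj; rewrite ?rs ?ra.
Qed.

Fact qcomp_1 p : qcomp (qtriv (qtarget p)) p = Some p.
Proof.
case: (qcompP (qtriv (qtarget p)) p) => [r _ rs ra _|[]//].
by congr Some; apply: qpath_inj; rewrite ?rs ?ra /= ?cats0.
Qed.

End Paths.

Section PathAlgebra.
Variables (K : fieldType) (G : quiver).

(* The path algebra K Gamma: the K-space with basis the paths, where the
   product of q and p is q p if defined and 0 otherwise. *)
Definition pathalg := {malg K[qpath G]}.
HB.instance Definition _ := GRing.Lmodule.on pathalg.

Definition pbasis (p : qpath G) : pathalg := << p >>.
Definition obasis (o : option (qpath G)) : pathalg := oapp pbasis 0 o.

Definition pathalg_mul (x y : pathalg) : pathalg :=
  \sum_(q <- msupp x) \sum_(p <- msupp y)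
    (x@_q * y@_p) *: obasis (qcomp q p).

Definition pathalg_one : pathalg := \sum_(v : vertex G) pbasis (qtriv v).

Fact pathalg_ind (P : pathalg -> Prop) :
  P 0 -> (forall x y, P x -> P y -> P (x + y)) ->
  (forall c p, P (c *: pbasis p)) -> forall x, P x.
Proof.
move=> P0 PD PZ x; rewrite [x]monalgE.
apply: big_ind => // p _; suff -> : << x@_p *g p >> = x@_p *: pbasis p by [].
apply/malgP=> k; apply: (etrans (mcoeffU _ _ _)); apply: esym.
apply: (etrans (mcoeffZ _ _ _)); rewrite [(pbasis p)@_k]mcoeffU.
exact: mulr_natr.
Qed.

Fact pathalg_mulEw (d1 d2 : {fset qpath G}) (x y : pathalg) :
  (msupp x `<=` d1)%fset -> (msupp y `<=` d2)%fset ->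
  pathalg_mul x y =
  \sum_(q <- d1) \sum_(p <- d2) (x@_q * y@_p) *: obasis (qcomp q p).
Proof.
move=> s1 s2; rewrite /pathalg_mul (big_fset_incl _ s1) /=; last first.
  by move=> q _ qx; rewrite big1 // => p _; rewrite mcoeff_outdom // mul0r scale0r.
apply: eq_bigr => q _; apply: big_fset_incl => // p _ px.
by rewrite (mcoeff_outdom px) mulr0 scale0r.
Qed.

Fact pathalg_mulDl : left_distributive pathalg_mul +%R.
Proof.
move=> x y z; pose d := (msupp x `|` msupp y `|` msupp (x + y))%fset.
rewrite !(@pathalg_mulEw d (msupp z))
  ?fsubset_refl //; try by apply/fsubsetP=> k; rewrite !inE => ->; rewrite ?orbT.
rewrite -big_split; apply: eq_bigr => q _; rewrite -big_split.
by apply: eq_bigr => p _; rewrite mcoeffD mulrDl scalerDl.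
Qed.

Fact pathalg_mulDr : right_distributive pathalg_mul +%R.
Proof.
move=> z x y; pose d := (msupp x `|` msupp y `|` msupp (x + y))%fset.
rewrite !(@pathalg_mulEw (msupp z) d)
  ?fsubset_refl //; try by apply/fsubsetP=> k; rewrite !inE => ->; rewrite ?orbT.
rewrite -big_split; apply: eq_bigr => q _; rewrite -big_split.
by apply: eq_bigr => p _; rewrite mcoeffD mulrDr scalerDl.
Qed.

Fact pathalg_scalerAl c x y : c *: pathalg_mul x y = pathalg_mul (c *: x) y.
Proof.
rewrite (@pathalg_mulEw (msupp x) (msupp y) (c *: x)) ?msuppZ_le ?fsubset_refl //.
rewrite scaler_sumr; apply: eq_bigr => q _; rewrite scaler_sumr.
by apply: eq_bigr => p _; rewrite scalerA mcoeffZ mulrA.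
Qed.

Fact pathalg_scalerAr c x y : c *: pathalg_mul x y = pathalg_mul x (c *: y).
Proof.
rewrite (@pathalg_mulEw (msupp x) (msupp y) x (c *: y)) ?msuppZ_le ?fsubset_refl //.
rewrite scaler_sumr; apply: eq_bigr => q _; rewrite scaler_sumr.
by apply: eq_bigr => p _; rewrite scalerA mcoeffZ mulrCA.
Qed.

Fact pathalg_mulb q p : pathalg_mul (pbasis q) (pbasis p) = obasis (qcomp q p).
Proof.
have cE r : (pbasis r)@_r = 1 by apply: mcoeffUU.
rewrite (pathalg_mulEw (@msuppU_le _ _ q 1) (@msuppU_le _ _ p 1)).
by rewrite !big_seq_fset1 (cE q) (cE p) (mulr1 1); apply: scale1r.
Qed.

Fact pathalg_mul0r : left_zero 0 pathalg_mul.
Proof. by move=> x; rewrite /pathalg_mul msupp0 big_seq_fset0. Qed.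
Fact pathalg_mulr0 : right_zero 0 pathalg_mul.
Proof.
by move=> x; rewrite /pathalg_mul msupp0 big1 // => ? _; rewrite big_seq_fset0.
Qed.

Fact pathalg_mulA : associative pathalg_mul.
Proof.
pose m := pathalg_mul; pose b := pbasis.
pose sc (c : K) (x : pathalg) : pathalg := c *: x; rewrite -/m.
have Al c x y : m (sc c x) y = sc c (m x y) by rewrite /m /sc pathalg_scalerAl.
have Ar c x y : m x (sc c y) = sc c (m x y) by rewrite /m /sc pathalg_scalerAr.
have Dl x y z : m (x + y) z = m x z + m y z by exact: pathalg_mulDl.
have Dr x y z : m x (y + z) = m x y + m x z by exact: pathalg_mulDr.
have l0 x : m 0 x = 0 by exact: pathalg_mul0r.
have r0 x : m x 0 = 0 by exact: pathalg_mulr0.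
have bb q p : m (b q) (b p) = oapp b 0 (qcomp q p) by exact: pathalg_mulb.
have ind : forall P : pathalg -> Prop, P 0 ->
  (forall x y, P x -> P y -> P (x + y)) -> (forall c p, P (sc c (b p))) ->
  forall x, P x by exact: pathalg_ind.
clearbody m b sc.
elim/ind => [|x x' IHx IHx'|c1 r] y z; first by rewrite !l0.
  by rewrite !Dl IHx IHx'.
rewrite !Al; congr (sc _ _).
elim/ind: y => [|y y' IHy IHy'|c2 q]; first by rewrite r0 l0 r0.
  by rewrite !Dr !Dl !Dr IHy IHy'.
rewrite !(Ar, Al); congr (sc _ _).
elim/ind: z => [|z z' IHz IHz'|c3 p]; first by rewrite !r0.
  by rewrite !Dr IHz IHz'.
rewrite !Ar !bb; congr (sc _ _).
have := qcompA r q p.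
case: (qcomp q p) (qcomp r q) => [s|] [t|] /= e.
- by rewrite !bb e.
- by rewrite bb e l0.
- by rewrite bb -e r0.
- by rewrite r0 l0.
Qed.

Fact pathalg_mul1r : left_id pathalg_one pathalg_mul.
Proof.
elim/pathalg_ind => [|x y IHx IHy|c p]; first exact: pathalg_mulr0.
  by rewrite pathalg_mulDr IHx IHy.
rewrite -pathalg_scalerAr; congr (_ *: _).
rewrite /pathalg_one (big_morph (pathalg_mul^~ (pbasis p))
  (fun x y => pathalg_mulDl x y (pbasis p)) (pathalg_mul0r (pbasis p))).
rewrite (bigD1 (qtarget p)) //= pathalg_mulb qcomp_1 big1 => [|v /eqP vp];
  first exact: addr0.
by rewrite pathalg_mulb; case: (qcompP (qtriv v) p) => // r /esym.
Qed.

Fact pathalg_mulr1 : right_id pathalg_one pathalg_mul.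
Proof.
elim/pathalg_ind => [|x y IHx IHy|c p]; first exact: pathalg_mul0r.
  by rewrite pathalg_mulDl IHx IHy.
rewrite -pathalg_scalerAl; congr (_ *: _).
rewrite /pathalg_one (big_morph (pathalg_mul (pbasis p))
  (pathalg_mulDr (pbasis p)) (pathalg_mulr0 (pbasis p))).
rewrite (bigD1 (qsource p)) //= pathalg_mulb qcomp1 big1 => [|v /eqP vp];
  first exact: addr0.
by rewrite pathalg_mulb; case: (qcompP p (qtriv v)).
Qed.

HB.instance Definition _ := GRing.Zmodule_isPzRing.Build pathalg
  pathalg_mulA pathalg_mul1r pathalg_mulr1 pathalg_mulDl pathalg_mulDr.

Fact pbasisM q p : pbasis q * pbasis p = obasis (qcomp q p).
Proof. exact: pathalg_mulb. Qed.

Definition arrow_ideal : ideal pathalg :=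
  gen_ideal [set pbasis (qarrow a) | a in [set: arrow G]].

Definition admissible (I : ideal pathalg) : Prop :=
  exists m : nat,
    [/\ (2 <= m)%N, ideal_exp arrow_ideal m `<=` I
      & I `<=` ideal_exp arrow_ideal 2].

Section Quotient.
Variable I : ideal pathalg.

(* The algebra K Gamma / I. *)
Definition pathquot := ringquot I.
HB.instance Definition _ := GRing.PzRing.on pathquot.

Definition pathquot_pi : pathalg -> pathquot := @ringquot_pi _ I.
HB.instance Definition _ := GRing.RMorphism.on pathquot_pi.

Definition pathquot_scale (c : K) (x : pathquot) : pathquot :=
  pathquot_pi (c *: (1 : pathalg)) * x.

Fact pathquot_pi_eq x y : pathquot_pi x = pathquot_pi y <-> I (x - y).
Proof. exact: (@ringquot_pi_eq _ I). Qed.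
Fact pathquot_pi_surj x : exists y, pathquot_pi y = x.
Proof. exact: (@ringquot_pi_surj _ I). Qed.

Fact pathquot_piZ c x : pathquot_scale c (pathquot_pi x) = pathquot_pi (c *: x).
Proof.
by rewrite /pathquot_scale -rmorphM /= -[_ * x]pathalg_scalerAl pathalg_mul1r.
Qed.

Fact pathquot_scaleA a b x :
  pathquot_scale a (pathquot_scale b x) = pathquot_scale (a * b) x.
Proof. by have [y <-] := pathquot_pi_surj x; rewrite !pathquot_piZ scalerA. Qed.
Fact pathquot_scale1 : left_id 1 pathquot_scale.
Proof. by move=> x; have [y <-] := pathquot_pi_surj x; rewrite pathquot_piZ scale1r. Qed.
Fact pathquot_scaleDr : right_distributive pathquot_scale +%R.
Proof. by move=> a x y; rewrite /pathquot_scale mulrDr. Qed.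
Fact pathquot_scaleDl x : {morph pathquot_scale^~ x : a b / a + b}.
Proof. by move=> a b; rewrite /pathquot_scale scalerDl rmorphD mulrDl. Qed.
HB.instance Definition _ := GRing.Zmodule_isLmodule.Build K pathquot
  pathquot_scaleA pathquot_scale1 pathquot_scaleDr pathquot_scaleDl.

Fact pathquot_scalerAl (c : K) (x y : pathquot) : c *: (x * y) = (c *: x) * y.
Proof. exact: mulrA. Qed.
Fact pathquot_scalerAr (c : K) (x y : pathquot) : c *: (x * y) = x * (c *: y).
Proof.
have [a <-] := pathquot_pi_surj x; have [b <-] := pathquot_pi_surj y.
rewrite -rmorphM -![_ *: _]/(pathquot_scale _ _) !pathquot_piZ -rmorphM.
by congr (pathquot_pi _); apply: pathalg_scalerAr.
Qed.

Definition finite_dimensional : Prop := fin_gen (pathquot : lmodType K).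

(* The classes in K Gamma / I of a path and of the idempotent of a vertex. *)
Definition pcls (p : qpath G) : pathquot := pathquot_pi (pbasis p).
Definition vcls (v : vertex G) : pathquot := pcls (qtriv v).

End Quotient.
End PathAlgebra.

(* Main.v *)
Require Import Defs.
From HB Require Import structures.
From mathcomp Require Import all_boot all_order all_algebra.
From mathcomp Require Import boolp classical_sets.
From mathcomp Require Import zify.
From mathcomp.multinomials Require Import monalg.

Set Implicit Arguments.
Unset Strict Implicit.
Unset Printing Implicit Defensive.

Import GRing.Theory.
Local Open Scope ring_scope.
Local Open Scope classical_set_scope.

(** Write R for the algebra. For each n let the zigzag module Z be generated by
    x_0, ..., x_n subject to p x_i = q x_(i+1) for i < n. As Rp and Rq meet in
    0, its relations form a direct sum of n copies of R(p,q)
    ([zigzag_relation_inj]), so Z has finite projective dimension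
    ([Pinfty_zigzag]). As p lies in the radical, x_0 can be sent to the
    generator of the simple module S_1 and the other x_i to 0.

    Let phi : A -> S_1 be an approximation. This map factors through phi, and
    the images of the e1 x_i are elements a_i of e1 A with p a_i = q a_(i+1),
    phi(a_0) <> 0 and phi(a_i) = 0 for i > 0. Under either of the two
    alternative hypotheses there is a subset N of JA which contains 0 and
    which contains every x in e1 A with p x in q N ([absorbing]): take e1 JA,
    respectively the kernel of p on e1 A. Suppose that c_m a_m + ... + c_n a_n
    = 0 with c_m <> 0. Pulling back along p and q lowers all indices by one:
    by induction on k <= m, the element c_m a_(m-k) + ... + c_n a_(n-k) lies
    in N. At k = m this element lies in JA, so phi kills it, whereas its image
    is c_m phi(a_0) ([zigzag_free]). Hence a_0, ..., a_n are independent over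
    K for every n, although A has finite dimension ([linear_dependence],
    [no_right_approximation]).

    For quivers, the scalars by which R acts on S_1 are read off from the
    augmentation R -> K that sends an element to its coefficient at the
    trivial path e1; it exists because the relations lie in the arrow ideal. *)

(** * Linear maps and projective dimension *)

Section LinearMaps.
Variable R : pzRingType.

Lemma linear_exists (M N : lmodType R) (f : M -> N) :
  linear f -> exists g : {linear M -> N}, g =1 f.
Proof.
move=> lf; pose m := GRing.isLinear.Build R M N *:%R f lf.
pose g : {linear M -> N} := HB.pack f m.
by exists g.
Qed.

Lemma quotmod_factor (M X : lmodType R) (N : submodule M) (f : {linear M -> X}) :
  (forall x, N x -> f x = 0) ->
  exists g : {linear quotmod N -> X}, forall x, g (quotmod_pi N x) = f x.
Proof.
move=> fN.
have fr x : f (repr (quotmod_pi N x)) = f x.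
  by apply/eqP; rewrite -subr_eq0 -raddfB; apply/eqP/fN/quotmod_pi_eq/quotmod_piK.
have [|g gE] := @linear_exists (quotmod N) X (fun x => f (repr x)).
  move=> a x y; rewrite -[x]quotmod_piK -[y]quotmod_piK -linearP.
  by rewrite !fr linearP.
by exists g => x; rewrite gE fr.
Qed.

Lemma projective_regular : projective (R^o : lmodType R).
Proof.
move=> M N g f gs; have [m gm] := gs (f 1).
have [|h hE] := @linear_exists R^o M (fun a => a *: m).
  by move=> a x y; rewrite scalerDl scalerA.
exists h => x; rewrite hE linearZ gm -linearZ; congr (f _); exact: mulr1.
Qed.

Definition delta (V : lmodType R) n (i : 'I_n) (v : V) : {ffun 'I_n -> V} :=
  [ffun j => if j == i then v else 0].

Lemma delta_linear (V : lmodType R) n (i : 'I_n) : linear (@delta V n i).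
Proof.
move=> a x y; apply/ffunP => j; rewrite !ffunE.
by case: eqP => // _; rewrite scaler0 addr0.
Qed.
HB.instance Definition _ (V : lmodType R) n (i : 'I_n) :=
  GRing.isLinear.Build R V {ffun 'I_n -> V} *:%R (@delta V n i)
    (@delta_linear V n i).

Lemma sum_delta (V : lmodType R) n (x : {ffun 'I_n -> V}) :
  x = \sum_i delta i (x i).
Proof.
apply/ffunP => j; rewrite sum_ffunE (bigD1 j) //= ffunE eqxx big1 ?addr0 //.
by move=> i ij; rewrite ffunE eq_sym (negPf ij).
Qed.

(** Lift each coordinate separately and add up. *)
Lemma projective_ffun (P : lmodType R) n :
  projective P -> projective ({ffun 'I_n -> P} : lmodType R).
Proof.
move=> Pp M N g f gs.
have /choice [h hE] (i : 'I_n) :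
    exists h : {linear P -> M}, forall x, g (h x) = f (delta i x).
  pose fi : {linear P -> N} := f \o @delta P n i.
  by have [h hE] := Pp _ _ g fi gs; exists h.
have [|k kE] := @linear_exists {ffun 'I_n -> P} M (fun x => \sum_i h i (x i)).
  move=> a x y; rewrite scaler_sumr -big_split; apply: eq_bigr => i _.
  by rewrite !ffunE linearP.
exists k => x; rewrite kE [in RHS](sum_delta x) !linear_sum.
by apply: eq_bigr => i _; apply: hE.
Qed.

Definition ffun_map (V W : Type) n (f : V -> W) (x : {ffun 'I_n -> V}) :
  {ffun 'I_n -> W} := [ffun i => f (x i)].

Lemma ffun_map_linear (V W : lmodType R) n (f : {linear V -> W}) :
  linear (@ffun_map V W n f).
Proof. by move=> a x y; apply/ffunP => i; rewrite !ffunE linearP. Qed.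
HB.instance Definition _ (V W : lmodType R) n (f : {linear V -> W}) :=
  GRing.isLinear.Build R {ffun 'I_n -> V} {ffun 'I_n -> W} *:%R
    (@ffun_map V W n f) (@ffun_map_linear V W n f).

Lemma quotmod_pi_eq0 (M : lmodType R) (N : submodule M) x :
  quotmod_pi N x = 0 <-> N x.
Proof. by rewrite -(linear0 (quotmod_pi N)) quotmod_pi_eq subr0. Qed.

Definition image_submod (V M : lmodType R) (f : {linear V -> M}) : submodule M.
Proof.
exists (range f).
- by exists 0; rewrite ?linear0.
- by move=> _ _ [x _ <-] [y _ <-]; exists (x + y); rewrite ?linearD.
- by move=> a _ [x _ <-]; exists (a *: x); rewrite ?linearZ.
Defined.

(** A finite power of a resolution is exact: preimages are chosen coordinatewise. *)
Lemma pdim_le_ffun (V : lmodType R) m n :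
  pdim_le m V -> pdim_le m ({ffun 'I_n -> V} : lmodType R).
Proof.
move=> [P [d [aug [Pproj Pend augS aug0 d0]]]].
have exact_ffun (A B C : lmodType R) (f : {linear A -> B}) (g : {linear B -> C})
    (fg : forall x, g x = 0 <-> exists y, f y = x) (x : {ffun 'I_n -> B}) :
    ffun_map g x = 0 <-> exists y, ffun_map f y = x.
  split=> [gx0|[y <-]]; last first.
    by apply/ffunP => i; rewrite !ffunE; apply/fg; exists (y i).
  have /choice [y yE] (i : 'I_n) : exists y, f y = x i.
    by apply/fg; move/ffunP: gx0 => /(_ i); rewrite !ffunE.
  by exists [ffun i => y i]; apply/ffunP => i; rewrite !ffunE.
exists (fun i => {ffun 'I_n -> P i}), (fun i => @ffun_map _ _ n (d i)),
  (@ffun_map _ _ n aug); split.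
- by move=> i; apply: projective_ffun.
- by move=> i mi x; apply/ffunP => j; rewrite ffunE; apply: Pend.
- move=> y; have /choice [x xE] (i : 'I_n) : exists x, aug x = y i by [].
  by exists [ffun i => x i]; apply/ffunP => i; rewrite !ffunE.
- exact: exact_ffun.
- by move=> i; apply: exact_ffun.
Qed.

(** Splice a resolution of [V] with the presentation of the cokernel. *)
Lemma pdim_le_coker (V F : lmodType R) (f : {linear V -> F}) m :
  projective F -> (forall x, f x = 0 -> x = 0) ->
  pdim_le m V -> pdim_le m.+1 (quotmod (image_submod f)).
Proof.
move=> Fproj f0 [P [d [aug [Pproj Pend augS aug0 d0]]]].
pose P' i := if i is j.+1 then P j else F.
pose d' i : {linear P' i.+1 -> P' i} :=
  match i with 0 => f \o aug | j.+1 => d j end.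
exists P', d', (quotmod_pi (image_submod f)); split.
- by case.
- by case=> // i; apply: Pend.
- exact: quotmod_pi_surj.
- move=> x; rewrite quotmod_pi_eq0; split=> [[v _ <-]|[y <-]].
    by have [y <-] := augS v; exists y.
  by exists (aug y).
- case=> [|i] x; last exact: d0.
  by rewrite -aug0; split=> [/f0|/= ->]; rewrite ?linear0.
Qed.

End LinearMaps.

(** * Zigzag modules *)

Section Zigzag.
Variables (R : pzRingType) (p q : R) (n : nat).

Local Notation C := (submod_type (cyclic ((p, q) : (R^o * R^o)%type))).

(** Sends (a_i p, a_i q)_i to the sum of the a_i (p x_i - q x_(i+1)): the
    generators x_i and x_(i+1) are those of index [lift ord_max i] and
    [lift ord0 i]. *)
Definition zigzag_relation (y : {ffun 'I_n -> C}) : {ffun 'I_n.+1 -> R^o} :=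
  [ffun j => oapp (fun i => (val (y i)).1) 0 (unlift ord_max j)
           - oapp (fun i => (val (y i)).2) 0 (unlift ord0 j)].

Lemma zigzag_relation_linear : linear zigzag_relation.
Proof.
move=> a x y; apply/ffunP => j; rewrite !ffunE scalerBr.
case: (unlift _ j) => [i|]; case: (unlift _ j) => [k|] /=;
  rewrite ?ffunE /= ?scaler0 ?oppr0 ?opprD ?addr0 ?add0r //.
exact: addrACA.
Qed.
HB.instance Definition _ := GRing.isLinear.Build R {ffun 'I_n -> C}
  {ffun 'I_n.+1 -> R^o} *:%R zigzag_relation zigzag_relation_linear.

(** Each coordinate of a relation is a difference of an element of [R p] and one
    of [R q], so it vanishes only if both terms do; every component of [y]
    occurs as such a term. *)
Lemma zigzag_relation_inj :
  cyclic (p : R^o) `&` cyclic (q : R^o) = [set 0] ->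
  forall y, zigzag_relation y = 0 -> y = 0.
Proof.
move=> pq0 y y0.
have disj (u v : R^o) : cyclic (p : R^o) u -> cyclic (q : R^o) v ->
    u - v = 0 -> u = 0 /\ v = 0.
  move=> pu qv /eqP; rewrite subr_eq0 => /eqP uv; subst v.
  suff: [set 0] u by move=> /= ->.
  by rewrite -pq0.
have yp o : cyclic (p : R^o) (oapp (fun i => (val (y i)).1) 0 o).
  case: o => [i|]; last exact: submod0.
  by rewrite /=; case: (y i) => u /= /asboolP [a _ <-]; exists a.
have yq o : cyclic (q : R^o) (oapp (fun i => (val (y i)).2) 0 o).
  case: o => [i|]; last exact: submod0.
  by rewrite /=; case: (y i) => u /= /asboolP [a _ <-]; exists a.
apply/ffunP => i; rewrite ffunE; apply: val_inj => /=.
rewrite [val (y i)]surjective_pairing.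
congr pair.
- move/ffunP: y0 => /(_ (lift ord_max i)); rewrite !ffunE liftK.
  by case/(disj _ _ (yp _) (yq _)).
- move/ffunP: y0 => /(_ (lift ord0 i)); rewrite !ffunE liftK.
  by case/(disj _ _ (yp _) (yq _)).
Qed.

Definition zigzag : lmodType R := quotmod (image_submod zigzag_relation).

Definition zigzag_gen (i : 'I_n.+1) : zigzag :=
  quotmod_pi (image_submod zigzag_relation) (delta i (1 : R^o)).

Lemma zigzag_genP (i : 'I_n) :
  p *: zigzag_gen (lift ord_max i) = q *: zigzag_gen (lift ord0 i).
Proof.
rewrite /zigzag_gen -!linearZ /=; apply/quotmod_pi_eq.
have pqC : submod_pred (cyclic ((p, q) : (R^o * R^o)%type)) (p, q).
  by apply/asboolP; exists 1; rewrite // scale1r.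
exists (delta i (Sub (p, q) pqC : C)) => //.
apply/ffunP => j; rewrite !ffunE; congr (_ - _).
- case: unliftP => [k ->|->] /=; last by rewrite (negPf (neq_lift _ _)).
  by rewrite (inj_eq lift_inj) ffunE; case: eqP => //= _; rewrite [RHS]mulr1.
- case: unliftP => [k ->|->] /=; last by [].
  by rewrite (inj_eq lift_inj) ffunE; case: eqP => //= _; rewrite [RHS]mulr1.
Qed.

Lemma Pinfty_zigzag :
  cyclic (p : R^o) `&` cyclic (q : R^o) = [set 0] -> finite_pdim C ->
  Pinfty zigzag.
Proof.
move=> pq0 [m Cm]; split.
  exists n.+1, zigzag_gen => x; have [y <-] := quotmod_pi_surj x.
  exists y; rewrite [in LHS](sum_delta y) linear_sum; apply: eq_bigr => i _.
  by rewrite -!linearZ /= [_ *: _]mulr1.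
exists m.+1; apply: pdim_le_coker.
- exact/projective_ffun/projective_regular.
- exact: zigzag_relation_inj.
- exact: pdim_le_ffun.
Qed.

(** All relations follow from those between consecutive generators, so nothing
    else has to be checked on the images. *)
Lemma zigzag_map (X : lmodType R) (x : 'I_n.+1 -> X) :
  (forall i : 'I_n, p *: x (lift ord_max i) = q *: x (lift ord0 i)) ->
  exists g : {linear zigzag -> X}, forall i, g (zigzag_gen i) = x i.
Proof.
move=> xP.
have [|f fE] := @linear_exists R {ffun 'I_n.+1 -> R^o} X
    (fun y => \sum_i (y i : R) *: x i).
  move=> a y z; rewrite scaler_sumr -big_split; apply: eq_bigr => i _.
  by rewrite !ffunE scalerA scalerDl.
have [|g gE] := @quotmod_factor R _ _ (image_submod zigzag_relation) f.
  move=> _ [y _ <-]; rewrite fE.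
  under eq_bigr => i _ do rewrite ffunE scalerBl.
  rewrite sumrB big_ord_recr [X in _ - X]big_ord_recl /= !unlift_none /=.
  rewrite !scale0r addr0 add0r -sumrB big1 // => i _.
  have -> : widen_ord (leqnSn n) i = lift ord_max i.
    by apply: val_inj; rewrite /= /bump leqNgt ltn_ord.
  rewrite !liftK /=; case: (y i) => u /= /asboolP [a _ <-] /=.
  by rewrite -!scalerA xP subrr.
exists g => i; rewrite gE fE (bigD1 i) //= ffunE eqxx scale1r big1 ?addr0 //.
by move=> j ji; rewrite ffunE (negPf ji) scale0r.
Qed.

End Zigzag.

(** * The radical and an augmentation *)

Section Radical.
Variable R : pzRingType.

Definition add_cyclic (L : submodule R^o) (x : R) : submodule R^o.
Proof.
exists [set y : R^o | exists (l : R^o) (a : R), L l /\ y = l + a * x].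
- by exists 0, 0; split; [apply: submod0 | rewrite mul0r addr0].
- move=> _ _ [l [a [Ll ->]]] [l' [a' [Ll' ->]]]; exists (l + l'), (a + a').
  by split; [apply: submodD | rewrite mulrDl addrACA].
- move=> b _ [l [a [Ll ->]]]; exists (b *: l), (b * a).
  by split; [apply: submodZ | rewrite -mulrA scalerDr].
Defined.

(** If a maximal left ideal [L] missed [x], then [1 - a * x] would lie in [L] for
    some [a], although the geometric series inverts it. *)
Lemma nilpotent_jacobson (x : R) :
  (forall a, exists m, (a * x) ^+ m = 0) -> jacobson R x.
Proof.
move=> nil L [Lproper Lmax]; apply: contrapT => nLx.
case: (Lmax (add_cyclic L x)) => [l Ll|LE|LE].
- by exists l, 0; rewrite mul0r addr0.
- apply: nLx; rewrite -LE.
  by exists 0, 1; split; [apply: submod0 | rewrite mul1r add0r].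
- have [l [a [Ll l1]]] : (add_cyclic L x : set R^o) 1 by rewrite LE.
  apply: Lproper; apply/predeqP => y; split=> // _.
  have [m axm] := nil a.
  have {}l1 : l = 1 - a * x by rewrite [X in X - _]l1 addrK.
  have inv : (\sum_(i < m) (a * x) ^+ i) * (1 - a * x) = 1.
    have -> : (\sum_(i < m) (a * x) ^+ i) * (1 - a * x) =
              (1 - a * x) * \sum_(i < m) (a * x) ^+ i.
      symmetry; apply: commr_sum => i _; apply/commrX/commr_sym/commrB.
        exact: commr1.
      exact: commr_refl.
    by apply: oppr_inj; rewrite -[LHS]mulNr opprB -subrX1 axm sub0r.
  by rewrite -[y]mulr1 -inv mulrA -l1; apply: (submodZ _ Ll).
Qed.

Variables (K : fieldType) (eps : {rmorphism R -> K}).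
Hypothesis eps_surj : forall c, exists r, eps r = c.

Definition eps_ker : submodule R^o.
Proof.
exists [set x : R^o | eps x = 0].
- exact: rmorph0.
- by move=> x y /= x0 y0; rewrite rmorphD x0 y0 addr0.
- by move=> a x /= x0; rewrite rmorphM x0 mulr0.
Defined.

(** The kernel of a surjection onto a field is a maximal left ideal. *)
Lemma eps_jacobson x : jacobson R x -> eps x = 0.
Proof.
move=> Jx; apply: (Jx eps_ker); split=> [/predeqP/(_ 1)[_ /(_ Logic.I)] /= /eqP|].
  by rewrite rmorph1 oner_eq0.
move=> L kerL; have [[z Lz z0]|] := pselect (exists2 z, L z & eps z <> 0).
  right; apply/predeqP => y; split=> // _.
  have [r rE] := eps_surj (eps y / eps z).
  rewrite -[y](subrK (r * z)); apply: submodD; last exact: submodZ.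
  apply: kerL; rewrite /= rmorphB rmorphM rE mulfVK ?subrr //; exact/eqP.
move=> nx; left; apply/predeqP => y; split=> [Ly|]; last exact: kerL.
by apply: contrapT => y0; apply: nx; exists y.
Qed.

Lemma radmod_vanish (A : lmodType R) (psi : A -> K) :
  (forall x y, psi (x + y) = psi x + psi y) ->
  (forall r x, psi (r *: x) = eps r * psi x) ->
  forall x, radmod A x -> psi x = 0.
Proof.
move=> psiD psiZ x.
have psi0 : psi 0 = 0 by rewrite -(scale0r (0 : A)) psiZ rmorph0 mul0r.
have kerD y z : psi y = 0 -> psi z = 0 -> psi (y + z) = 0.
  by move=> y0 z0; rewrite psiD y0 z0 addr0.
have kerZ r y : psi y = 0 -> psi (r *: y) = 0.
  by move=> y0; rewrite psiZ y0 mulr0.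
move=> /(_ (Submodule psi0 kerD kerZ)); apply=> _ [j Jj [y _ <-]].
by rewrite /= psiZ (eps_jacobson Jj) mul0r.
Qed.

(** [eps] vanishes on [J e], so it descends to a coordinate [psi] of [R e / J e];
    the witness [s] is the class of [e]. *)
Lemma top_functional (e : R) : eps e = 1 ->
  exists (psi : top_at e -> K) (s : top_at e),
  [/\ forall x y, psi (x + y) = psi x + psi y,
      forall (r : R) x, psi (r *: x) = eps r * psi x,
      psi s = 1
    & forall r : R, jacobson R r -> r *: s = 0].
Proof.
move=> eps_e.
pose Je := submod_in (cyclic (e : R^o)) (lideal_mulr (jacobson R) e).
pose psi (s : top_at e) : K := eps (val (repr s)).
have psiE x : psi (quotmod_pi Je x) = eps (val x).
  have /quotmod_pi_eq [j Jj jE] := quotmod_piK (quotmod_pi Je x).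
  apply/eqP; rewrite -subr_eq0 -rmorphB.
  have <- : j * e = val (repr (quotmod_pi Je x)) - val x by rewrite jE.
  by rewrite rmorphM eps_jacobson ?mul0r.
have eC : submod_pred (cyclic (e : R^o)) e.
  by apply/asboolP; exists 1; rewrite // scale1r.
exists psi, (quotmod_pi Je (Sub (e : R^o) eC)); split=> [x y|r x||r Jr].
- rewrite -[x]quotmod_piK -[y]quotmod_piK -linearD !psiE; exact: rmorphD.
- rewrite -[x]quotmod_piK -linearZ !psiE; exact: rmorphM.
- by rewrite psiE SubK.
- by rewrite -linearZ; apply/quotmod_pi_eq0; exists r.
Qed.

End Radical.

(** * Linear independence along a zigzag *)

Section Dependence.
Variables (R : pzRingType) (K : fieldType) (sc : {rmorphism K -> R}).

(** [A] is spanned over [K] by the products of the generators of [R] and of [A],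
    so [d] is the number of these products. *)
Lemma linear_dependence (A : lmodType R) s (l : 'I_s -> R) :
  (forall r, exists c : 'I_s -> K, r = \sum_i sc (c i) * l i) -> fin_gen A ->
  exists d, forall a : nat -> A, exists c : 'I_d.+1 -> K,
    (exists i, c i != 0) /\ \sum_i sc (c i) *: a i = 0.
Proof.
move=> lP [t [g gP]];
have span_lg x : exists c : 'I_t * 'I_s -> K,
    x = \sum_u sc (c u) *: (l u.2 *: g u.1).
  have [b ->] := gP x; have /choice [c cP] i := lP (b i).
  exists (fun u => c u.1 u.2).
  under eq_bigr => i _ do rewrite (cP i) scaler_suml.
  by rewrite pair_bigA; apply: eq_bigr => u _; rewrite scalerA.
exists #|{: 'I_t * 'I_s}| => a; have /choice [C CP] i := span_lg (a i).
pose M :=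
  \matrix_(i < #|{: 'I_t * 'I_s}|.+1, u < #|{: 'I_t * 'I_s}|) C i (enum_val u).
have : kermx M != 0.
  rewrite kermx_eq0 /row_free.
  by apply: contraTneq (rank_leq_col M) => ->; rewrite ltnn.
move: (kermx M) (mulmx_ker M) => B BM /matrix0Pn [i [j ij]].
exists (B i); split; first by exists j.
under eq_bigr => k _ do rewrite (CP k) scaler_sumr.
rewrite exchange_big big1 //= => u _.
under eq_bigr => k _ do rewrite scalerA -rmorphM.
rewrite -scaler_suml -rmorph_sum /=.
suff -> : \sum_k B i k * C k u = 0 by rewrite rmorph0 scale0r.
have /matrixP/(_ i (enum_rank u)) := BM; rewrite !mxE => {2}<-.
by apply: eq_bigr => k _; rewrite mxE enum_rankK.
Qed.

Hypothesis scC : forall c r, sc c * r = r * sc c.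
Variables (e p q : R) (A : lmodType R) (N : set A) (psi : A -> K).
Hypotheses (N0 : N 0).
Hypothesis N_pull : forall x y, e *: x = x -> p *: x = q *: y -> N y -> N x.
Hypothesis psiD : forall x y, psi (x + y) = psi x + psi y.
Hypothesis psiZ : forall c x, psi (sc c *: x) = c * psi x.
Hypothesis psiN : forall x, N x -> psi x = 0.

(** A dependence relation whose first nonzero coefficient is [c m] is shifted
    down [m] steps by [N_pull]; what remains is seen by [psi] as [c m]. *)
Lemma zigzag_free n (a : nat -> A) (c : nat -> K) :
  (forall i, e *: a i = a i) ->
  (forall i, (i < n)%N -> p *: a i = q *: a i.+1) ->
  (forall i, (i <= n)%N -> psi (a i) = (i == 0%N)%:R) ->
  \sum_(0 <= i < n.+1) sc (c i) *: a i = 0 ->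
  forall i, (i <= n)%N -> c i = 0.
Proof.
move=> ea pq psia ca0 i; move: i.
suff min_c m : (m <= n)%N -> (forall i, (i < m)%N -> c i = 0) -> c m = 0.
  elim/ltn_ind=> i IH le_in; apply: min_c => // j ji.
  exact/IH/ltnW/(leq_trans ji).
move=> mn cm.
(* Indices i >= m >= k only, so that i - k is not truncated. *)
have shift k : (k <= m)%N -> N (\sum_(m <= i < n.+1) sc (c i) *: a (i - k)%N).
  elim: k => [_|k IH km].
    rewrite (big_cat_nat (n := m)) //= in ca0; last exact: leqW.
    rewrite big_nat_cond big1 ?add0r in ca0; last first.
      by move=> i /andP[/andP[_ /cm ->]]; rewrite rmorph0 scale0r.
    by under eq_bigr => i _ do rewrite subn0; rewrite ca0.
  apply: N_pull (IH (ltnW km)).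
    rewrite scaler_sumr; apply: eq_bigr => i _.
    by rewrite scalerA -scC -scalerA ea.
  rewrite !scaler_sumr big_nat [RHS]big_nat; apply: eq_bigr => i /andP[mi in1].
  rewrite !scalerA -!scC -!scalerA pq; last by lia.
  by rewrite subnSK //; lia.
have psi0 : psi 0 = 0 by rewrite -(scale0r (0 : A)) -(rmorph0 sc) psiZ mul0r.
move: (psiN (shift m (leqnn m))).
rewrite (big_morph psi psiD psi0) big_nat_recl // subnn psiZ psia // mulr1.
rewrite big_nat_cond big1 ?addr0 // => i /andP[/andP[mi lt_in] _].
rewrite psiZ psia; last by lia.
by rewrite subSn // mulr0.
Qed.

End Dependence.

(** * The criterion for an augmented finite dimensional algebra *)

(** The common consequence of the two alternative conditions on [M]. The closure
    of [N] lets a dependence relation be shifted down a zigzag. *)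
Definition absorbing (R : pzRingType) (e p q : R) (M : lmodType R) : Prop :=
  exists N : set M,
    [/\ N 0,
        forall x y, e *: x = x -> p *: x = q *: y -> N y -> N x
      & N `<=` radmod M].

Section Criterion.
Variables (R : pzRingType) (K : fieldType).
Variables (sc : {rmorphism K -> R}) (eps : {rmorphism R -> K}).
Hypothesis scC : forall c r, sc c * r = r * sc c.
Hypothesis eps_sc : forall c, eps (sc c) = c.
Variables (d : nat) (l : 'I_d -> R).
Hypothesis lP : forall r, exists c : 'I_d -> K, r = \sum_i sc (c i) * l i.
Variables e p q : R.
Hypotheses (ee : e * e = e) (eps_e : eps e = 1) (pe : p * e = p) (qe : q * e = q).
Hypothesis Jp : jacobson R p.

Lemma no_right_approximation :
  cyclic (p : R^o) `&` cyclic (q : R^o) = [set 0] ->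
  finite_pdim (submod_type (cyclic ((p, q) : (R^o * R^o)%type))) ->
  (forall M : lmodType R, Pinfty M -> absorbing e p q M) ->
  ~ has_right_approximation (@Pinfty R) (top_at e).
Proof.
move=> pq0 pdC NP [A [phi [PA approx]]].
have eps_surj c : exists r, eps r = c by exists (sc c).
have [psi [s [psiD psiZ psi_s Js]]] := top_functional eps_surj eps_e.
pose chi x := psi (phi x).
have chiD x y : chi (x + y) = chi x + chi y by rewrite /chi linearD psiD.
have chiZ r x : chi (r *: x) = eps r * chi x by rewrite /chi linearZ psiZ.
have chi_sc c x : chi (sc c *: x) = c * chi x by rewrite chiZ eps_sc.
have [N [N0 N_pull N_rad]] := NP A PA.
have chiN x : N x -> chi x = 0.
  by move=> /N_rad; apply: (radmod_vanish eps_surj chiD chiZ).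
(* Any n + 1 elements of A are dependent: this fixes the length of the zigzag. *)
have [n depA] := linear_dependence lP PA.1.
have [|g gE] := @zigzag_map _ p q n _ (fun i => if i == ord0 then s else 0).
  have kill (r : R) (b : bool) : jacobson R r -> r *: (if b then s else 0) = 0.
    by case: b => Jr; rewrite ?scaler0 ?Js.
  by move=> i; rewrite (kill _ _ Jp) /= scaler0.
have [h hE] := approx _ g (Pinfty_zigzag n pq0 pdC).
pose z i := h (zigzag_gen p q i).
have zP (i : 'I_n) : p *: z (lift ord_max i) = q *: z (lift ord0 i).
  by have := congr1 h (zigzag_genP p q i); rewrite !linearZ.
have chi_z i : chi (z i) = (i == ord0)%:R.
  rewrite /chi hE gE; case: eqP => // _.
  by rewrite -(scale0r s) psiZ rmorph0 mul0r.
clearbody z; pose a i := e *: z (inord i).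
have [c [[i0 ci0] ca0]] := depA a.
suff c0 i : (i <= n)%N -> c (inord i) = 0.
  by move: ci0; rewrite -[i0]inord_val c0 ?eqxx // -ltnS.
apply: (zigzag_free scC N0 N_pull chiD chi_sc chiN
  (a := a) (c := fun i => c (inord i))).
- by move=> j; rewrite scalerA ee.
- move=> j jn; rewrite /a !scalerA pe qe.
  have := zP (Ordinal jn).
  have -> : lift ord_max (Ordinal jn) = inord j.
    by apply: val_inj; rewrite /= inordK ?leqW // /bump leqNgt jn.
  have -> : lift ord0 (Ordinal jn) = inord j.+1.
    by apply: val_inj; rewrite /= inordK.
  by [].
- by move=> j jn; rewrite chiZ eps_e mul1r chi_z -val_eqE /= inordK.
- by rewrite big_mkord -[RHS]ca0; apply: eq_bigr => j _; rewrite inord_val.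
Qed.

Lemma absorbing_of_disjoint (M : lmodType R) :
  [set p *: x | x in emul e [set: M] `\` radmod M] `&`
  [set q *: x | x in emul e (radmod M)] = set0 ->
  absorbing e p q M.
Proof.
move=> disj; exists (emul e (radmod M)); split=> [|x y ex pxqy Ny|_ [x Jx <-]].
- by exists 0; [apply: submod0 | rewrite scaler0].
- apply: contrapT => Nx; suff: set0 (p *: x) by [].
  rewrite -disj; split; last by exists y.
  exists x => //; split; first by exists x.
  by move=> Jx; apply: Nx; exists x.
- exact: submodZ.
Qed.

Lemma absorbing_of_eker (M : lmodType R) :
  eker M e p `<=` eker M e q -> eker M e p `<=` emul e (radmod M) ->
  absorbing e p q M.
Proof.
move=> ker_pq ker_rad.
exists (eker M e p); split=> [|x y ex pxqy /ker_pq[_ qy]|x /ker_rad[y Jy <-]].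
- by split; [exists 0; rewrite ?scaler0 | rewrite scaler0].
- by split; [exists x | rewrite pxqy].
- exact: submodZ.
Qed.

End Criterion.

(** * Path algebras modulo relations *)

Section PathAlgebras.
Variables (K : fieldType) (G : quiver).

Lemma coef_pbasis (p r : qpath G) : (pbasis K p)@_r = (p == r)%:R.
Proof. exact: mcoeffU. Qed.

(** A composite path is trivial only if both factors are the same trivial path. *)
Lemma trivial_coefM v (x y : pathalg K G) :
  (x * y)@_(qtriv v) = x@_(qtriv v) * y@_(qtriv v).
Proof.
(* Only bilinearity and the values on pairs of paths matter. *)
pose f (z : pathalg K G) : K := z@_(qtriv v); rewrite -![_@__]/(f _).
pose b := @pbasis K G; pose sc (c : K) (z : pathalg K G) : pathalg K G := c *: z.
pose m := @pathalg_mul K G; rewrite -[x * y]/(m x y).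
have fD y1 y2 : f (y1 + y2) = f y1 + f y2 by exact: mcoeffD.
have f0 : f 0 = 0 by exact: mcoeff0.
have fZ c y1 : f (sc c y1) = c * f y1 by exact: mcoeffZ.
have fb p : f (b p) = (p == qtriv v)%:R by exact: coef_pbasis.
have mDl x1 x2 y1 : m (x1 + x2) y1 = m x1 y1 + m x2 y1.
  exact: pathalg_mulDl.
have mDr x1 y1 y2 : m x1 (y1 + y2) = m x1 y1 + m x1 y2.
  exact: pathalg_mulDr.
have mZl c x1 y1 : m (sc c x1) y1 = sc c (m x1 y1).
  by rewrite /m /sc pathalg_scalerAl.
have mZr c x1 y1 : m x1 (sc c y1) = sc c (m x1 y1).
  by rewrite /m /sc pathalg_scalerAr.
have m0l x1 : m 0 x1 = 0 by exact: pathalg_mul0r.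
have m0r x1 : m x1 0 = 0 by exact: pathalg_mulr0.
have mb q p : m (b q) (b p) = oapp b 0 (qcomp q p) by exact: pathalg_mulb.
have ind (P : pathalg K G -> Prop) : P 0 ->
  (forall x y, P x -> P y -> P (x + y)) -> (forall c p, P (sc c (b p))) ->
  forall x, P x by exact: pathalg_ind.
clearbody f b sc m.
elim/ind: x => [|x x' IHx IHx'|c q]; first by rewrite m0l f0 mul0r.
  by rewrite mDl !fD IHx IHx' mulrDl.
rewrite mZl !fZ -mulrA; congr (_ * _).
elim/ind: y => [|y y' IHy IHy'|d p]; first by rewrite m0r f0 mulr0.
  by rewrite mDr !fD IHy IHy' mulrDr.
rewrite mZr !fZ mulrCA; congr (_ * _).
rewrite mb !fb -natrM mulnb.
case: (qcompP q p) => [r pq rs ra _|pq] /=; last first.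
  rewrite f0; case: andP => // -[/eqP qv /eqP pv].
  by case: pq; rewrite qv pv.
rewrite fb; congr ((nat_of_bool _)%:R); apply/eqP/andP=> [rv|[/eqP qv /eqP pv]].
  move: ra rs; rewrite rv => /esym/eqP /=; rewrite -size_eq0 size_cat addn_eq0.
  rewrite !size_eq0 => /andP[/eqP p0 /eqP q0] vp.
  have qp : qsource q = v by rewrite -pq /qtarget p0.
  by split; apply/eqP/qpath_inj.
by apply: qpath_inj; rewrite ?rs ?ra ?qv ?pv.
Qed.

Lemma trivial_coef1 v : (1 : pathalg K G)@_(qtriv v) = 1.
Proof.
rewrite raddf_sum /= (bigD1 v) //= coef_pbasis eqxx big1 ?addr0 // => w /eqP wv.
by rewrite coef_pbasis; case: eqP => // -[].
Qed.

Lemma ideal_mul_subl (A B : ideal (pathalg K G)) : ideal_mul A B `<=` A.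
Proof. by move=> x; apply=> _ [a Aa [b Bb <-]]; apply: Defs.idealMr. Qed.

Lemma trivial_coef_arrow_ideal v x : arrow_ideal K G x -> x@_(qtriv v) = 0.
Proof.
have kD (y z : pathalg K G) :
    y@_(qtriv v) = 0 -> z@_(qtriv v) = 0 -> (y + z)@_(qtriv v) = 0.
  by move=> y0 z0; rewrite mcoeffD y0 z0 addr0.
have kl (a y : pathalg K G) : y@_(qtriv v) = 0 -> (a * y)@_(qtriv v) = 0.
  by move=> y0; rewrite trivial_coefM y0 mulr0.
have kr (a y : pathalg K G) : y@_(qtriv v) = 0 -> (y * a)@_(qtriv v) = 0.
  by move=> y0; rewrite trivial_coefM y0 mul0r.
move=> /(_ (Ideal (mcoeff0 _ : (0 : pathalg K G)@_(qtriv v) = 0) kD kl kr)).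
by apply=> _ [a _ <-]; rewrite /= coef_pbasis; case: eqP.
Qed.

Lemma path_arrow_ideal (p : qpath G) :
  qarrows p <> [::] -> arrow_ideal K G (pbasis K p).
Proof.
case: p => -[v [//|a s]] /= w _ A SA.
have /andP[/eqP av ws] := w.
pose r := @QPath G (atarget a, s) ws.
suff -> : pbasis K (@QPath G (v, a :: s) w) = pbasis K r * pbasis K (qarrow a).
  by apply: Defs.idealMl; apply: SA; exists a.
rewrite pbasisM; case: (qcompP r (qarrow a)) => [t _ ts ta _|[]//].
rewrite /= -/(pbasis K t); congr (pbasis K _).
by apply: qpath_inj; rewrite ?ts ?ta //= /qsource.
Qed.

Lemma ideal_exp_pow (A : ideal (pathalg K G)) x m : A x -> ideal_exp A m (x ^+ m).
Proof.
move=> Ax; elim: m => [|m IH]; first by move=> J; apply.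
by move=> J SJ; apply: SJ; exists x => //; exists (x ^+ m); rewrite // exprS.
Qed.

Variable I : ideal (pathalg K G).
Local Notation L := (pathquot I).

Lemma pcls_source (p : qpath G) : pcls I p * vcls I (qsource p) = pcls I p.
Proof.
rewrite -[LHS](rmorphM (@pathquot_pi K G I)).
by congr (pathquot_pi I _); rewrite pbasisM qcomp1.
Qed.

Fact scalar_zmod_morphism : zmod_morphism (fun c : K => c *: (1 : L)).
Proof. by move=> c d; rewrite scalerBl. Qed.
Fact scalar_monoid_morphism : monoid_morphism (fun c : K => c *: (1 : L)).
Proof.
split=> [|c d]; first exact: scale1r.
by rewrite -[RHS]pathquot_scalerAl mul1r scalerA.
Qed.

Lemma scalar_exists : exists sc : {rmorphism K -> L}, forall c, sc c = c *: (1 : L).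
Proof.
pose z := GRing.isZmodMorphism.Build K L _ scalar_zmod_morphism.
pose m := GRing.isMonoidMorphism.Build K L _ scalar_monoid_morphism.
pose f : {rmorphism K -> L} := HB.pack (fun c : K => c *: (1 : L)) z m.
by exists f.
Qed.

(** The coefficient at the trivial path vanishes on the arrow ideal, hence it is
    well defined on representatives modulo [I]. *)
Lemma augmentation_exists v : I `<=` arrow_ideal K G ->
  exists eps : {rmorphism L -> K},
    forall x, eps (pathquot_pi I x) = x@_(qtriv v).
Proof.
move=> IA; pose f (x : L) := (repr x : pathalg K G)@_(qtriv v).
have fE x : f (pathquot_pi I x) = x@_(qtriv v).
  apply/eqP; rewrite -subr_eq0 -mcoeffB; apply/eqP/trivial_coef_arrow_ideal/IA.
  exact/pathquot_pi_eq/ringquot_piK.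
have fB : zmod_morphism f.
  move=> x y; have [x' <-] := pathquot_pi_surj x; have [y' <-] := pathquot_pi_surj y.
  by rewrite -rmorphB !fE mcoeffB.
have fM : monoid_morphism f.
  split=> [|x y]; first by rewrite -(rmorph1 (@pathquot_pi K G I)) fE trivial_coef1.
  have [x' <-] := pathquot_pi_surj x; have [y' <-] := pathquot_pi_surj y.
  by rewrite -rmorphM !fE trivial_coefM.
pose z := GRing.isZmodMorphism.Build L K _ fB.
pose m := GRing.isMonoidMorphism.Build L K _ fM.
by exists (HB.pack f z m : {rmorphism L -> K}).
Qed.

(** Left multiples of [p] lie in the arrow ideal, so they are nilpotent modulo
    [I]. *)
Lemma pcls_jacobson (p : qpath G) : admissible I ->
  qarrows p <> [::] -> jacobson L (pcls I p).
Proof.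
move=> [m [_ mI _]] pn; apply: nilpotent_jacobson => a; exists m.
have [a' <-] := pathquot_pi_surj a.
rewrite -rmorphM -rmorphXn -(rmorph0 (@pathquot_pi K G I)).
apply/pathquot_pi_eq; rewrite subr0; apply/mI/ideal_exp_pow/Defs.idealMl.
exact: path_arrow_ideal.
Qed.

End PathAlgebras.

(** If [p] were trivial, then [q = q p] would lie in both left ideals. *)
Lemma long_path_of_disjoint K G (I : ideal (pathalg K G)) (p q : qpath G) :
  qsource p = qsource q -> ~ I (pbasis K q) ->
  (forall x, cyclic (pcls I p : (pathquot I)^o) x ->
    cyclic (pcls I q : (pathquot I)^o) x -> x = 0) -> qarrows p <> [::].
Proof.
move=> spq qNI pq0 p0; apply: qNI.
have pE : p = qtriv (qsource q) by apply: qpath_inj; rewrite ?p0.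
have : pcls I q = 0.
  apply: pq0; last by exists 1; rewrite // scale1r.
  by exists (pcls I q) => //; rewrite pE; exact: pcls_source.
by rewrite -(rmorph0 (@pathquot_pi K G I)) => /pathquot_pi_eq; rewrite subr0.
Qed.

Theorem mainTheorem2 (K : fieldType) (G : quiver) (I : ideal (pathalg K G))
    (admI : admissible I) (fdI : finite_dimensional I)
    (e1 e2 : vertex G) (p q : qpath G)
    (p_from : qsource p = e1) (p_to : qtarget p = e2)
    (q_from : qsource q = e1) (q_to : qtarget q = e2)
    (pNI : ~ I (pbasis K p)) (qNI : ~ I (pbasis K q))
    (pq0 : cyclic (pcls I p : (pathquot I)^o) `&`
           cyclic (pcls I q : (pathquot I)^o) = [set 0])
    (hi : finite_pdim (submod_type (cyclic
            ((pcls I p, pcls I q) : ((pathquot I)^o * (pathquot I)^o)%type))))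
    (hii :
      (forall M : lmodType (pathquot I), Pinfty M ->
         [set pcls I p *: x | x in emul (vcls I e1) [set: M] `\` radmod M] `&`
         [set pcls I q *: x | x in emul (vcls I e1) (radmod M)] = set0) \/
      (forall M : lmodType (pathquot I), Pinfty M ->
         eker M (vcls I e1) (pcls I p) `<=` eker M (vcls I e1) (pcls I q) /\
         eker M (vcls I e1) (pcls I p) `<=` emul (vcls I e1) (radmod M))) :
  ~ has_right_approximation (@Pinfty (pathquot I)) (top_at (vcls I e1)).
Proof.
have pe : pcls I p * vcls I e1 = pcls I p.
  by have := pcls_source I p; rewrite p_from.
have qe : pcls I q * vcls I e1 = pcls I q.
  by have := pcls_source I q; rewrite q_from.
have ee : vcls I e1 * vcls I e1 = vcls I e1 by exact: (pcls_source I (qtriv e1)).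
have disj x : cyclic (pcls I p : (pathquot I)^o) x ->
    cyclic (pcls I q : (pathquot I)^o) x -> x = 0.
  by move=> px qx; suff: [set 0] x by []; rewrite -pq0.
have spq : qsource p = qsource q by rewrite p_from.
have pn : qarrows p <> [::] := long_path_of_disjoint spq qNI disj.
have [sc scE] := scalar_exists I.
have scC c r : sc c * r = r * sc c.
  by rewrite scE -pathquot_scalerAl -pathquot_scalerAr mul1r mulr1.
have [eps epsE] : exists eps : {rmorphism pathquot I -> K},
    forall x, eps (pathquot_pi I x) = (x : pathalg K G)@_(qtriv e1).
  by apply: augmentation_exists; case: admI => m [_ _ I2] x /I2 /ideal_mul_subl.
have eps_sc c : eps (sc c) = c.
  rewrite scE -[X in c *: X](rmorph1 (@pathquot_pi K G I)).
  rewrite [X in eps X]pathquot_piZ epsE.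
  by rewrite [LHS]mcoeffZ trivial_coef1 mulr1.
have eps_e : eps (vcls I e1) = 1 by rewrite epsE coef_pbasis eqxx.
have [k [l lP]] := fdI.
have lP' r : exists c : 'I_k -> K, r = \sum_i sc (c i) * l i.
  have [c ->] := lP r; exists c; apply: eq_bigr => i _.
  by rewrite scE -pathquot_scalerAl mul1r.
refine (no_right_approximation scC eps_sc lP' ee eps_e pe qe
  (pcls_jacobson admI pn) pq0 hi _) => M PM.
case: hii => /(_ M PM) => [|[]].
  exact: absorbing_of_disjoint.
exact: absorbing_of_eker.
Qed.
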